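(* Let $X,Y$ be compact nilspaces of finite step, and let $\phi:X\to Y$ be a Borel measurable morphism. Then $\phi$ is continuous.
   Context: Nilspaces. A morphism of discrete cubes $\{0,1\}^m\to\{0,1\}^n$ is a map that is the restriction of an affine homomorphism $\mathbb{Z}^m\to\mathbb{Z}^n$. A cubespace is a set $X$ with sets $\mathrm{C}^n(X)\subset X^{\{0,1\}^n}$ ($n\ge 0$), $\mathrm{C}^0(X)=X$, such that $c\circ\phi\in \mathrm{C}^m(X)$ for every $c\in \mathrm{C}^n(X)$ and every morphism $\phi:\{0,1\}^m\to\{0,1\}^n$. A nilspace is a non-empty cubespace $X$ satisfying ergodicity: $\mathrm{C}^1(X)=X^{\{0,1\}}$; and corner completion: for every $n\ge1$ and every $c':\{0,1\}^n\setminus\{1^n\}\to X$ whose restriction to each $(n-1)$-dimensional face containing $0^n$ is in $\mathrm{C}^{n-1}(X)$ (such a $c'$ is an $n$-corner), there is $c\in \mathrm{C}^n(X)$ with $c(v)=c'(v)$ for all $v\ne 1^n$. It is $k$-step if this completion is unique for $n=k+1$, and of finite step if it is $k$-step for some $k$. A morphism $\phi:X\to Y$ between cubespaces is a map with $\phi\circ c\in \mathrm{C}^n(Y)$ for all $n$ and all $c\in \mathrm{C}^n(X)$. Compactness. ''Compact space'' means compact Hausdorff second-countable topological space. A compact nilspace is a nilspace $X$ that is a compact space and such that $\mathrm{C}^n(X)$ is closed in $X^{\{0,1\}^n}$ for every $n$. *)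

(* Defs.v *)
From HB Require Import structures.
From mathcomp Require Import all_boot all_order all_algebra.
From mathcomp Require Import all_classical all_analysis.

Set Implicit Arguments.
Unset Strict Implicit.
Unset Printing Implicit Defensive.

Import GRing.Theory.

Local Open Scope classical_set_scope.
Local Open Scope ring_scope.

Definition cube (n : nat) := {ffun 'I_n -> bool}.

Definition cube_one (n : nat) : cube n := [ffun=> true].

Definition cube_int (n : nat) (v : cube n) : 'rV[int]_n :=
  \row_(i < n) (nat_of_bool (v i))%:Z.

Definition cube_morphism (m n : nat) (f : cube m -> cube n) : Prop :=
  exists (A : {additive 'rV[int]_m -> 'rV[int]_n}) (b : 'rV[int]_n),
    forall v : cube m, cube_int (f v) = A (cube_int v) + b.

(* Parametrizes the n-dimensional face [v i = 0] of the (n+1)-cube; these are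
   exactly the n-dimensional faces that contain the origin. *)
Definition cube_face (n : nat) (i : 'I_n.+1) (w : cube n) : cube n.+1 :=
  [ffun j => if unlift i j is Some k then w k else false].

Section Cubespaces.
Variable X : Type.

Definition cube_family := forall n : nat, set (cube n -> X).

Implicit Type C : cube_family.

Record cubespace C : Prop := Cubespace {
  cubespace0 : C 0%N = setT ;
  cubespace_comp : forall (m n : nat) (c : cube n -> X) (f : cube m -> cube n),
    C n c -> cube_morphism f -> C m (c \o f) }.

(* A corner is a map on the cube minus its top vertex. It is encoded by a map
   on the whole cube whose value at the top vertex is irrelevant: no face
   [v i = 0] contains that vertex, and [completes] ignores it. *)
Definition corner C (n : nat) (c' : cube n.+1 -> X) : Prop :=
  forall i : 'I_n.+1, C n (c' \o cube_face i).

Definition completes (n : nat) (c' c : cube n -> X) : Prop :=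
  forall v : cube n, v != cube_one n -> c v = c' v.

Record nilspace C : Prop := Nilspace {
  nilspace_neq0 : [set: X] !=set0 ;
  nilspace_cubespace : cubespace C ;
  nilspace_ergodic : C 1%N = setT ;
  nilspace_corner : forall (n : nat) (c' : cube n.+1 -> X),
    corner C c' -> exists c, C n.+1 c /\ completes c' c }.

Definition step C (k : nat) : Prop :=
  forall c' : cube k.+1 -> X,
    corner C c' -> exists! c, C k.+1 c /\ completes c' c.

Definition finite_step C : Prop := exists k : nat, step C k.

End Cubespaces.

Definition cubespace_morphism (X Y : Type)
    (CX : cube_family X) (CY : cube_family Y) (phi : X -> Y) : Prop :=
  forall (n : nat) (c : cube n -> X), CX n c -> CY n (phi \o c).

Record compact_nilspace (X : topologicalType) (C : cube_family X) : Prop :=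
  CompactNilspace {
    compact_nilspace_compact : compact [set: X] ;
    compact_nilspace_hausdorff : hausdorff_space X ;
    compact_nilspace_countable : @second_countable X ;
    compact_nilspace_nilspace : nilspace C ;
    compact_nilspace_closed : forall n : nat,
      closed (C n : set (prod_topology (fun _ : cube n => X))) }.

(* This is [measurable_fun setT phi] for the types
   [g_sigma_algebraType (@open _)], without making X and Y pointed. *)
Definition borel_measurable (X Y : topologicalType) (phi : X -> Y) : Prop :=
  forall B : set Y, <<s @open Y >> B -> <<s @open X >> (phi @^-1` B).

(* Main.v *)
Require Import Defs.
From HB Require Import structures.
From mathcomp Require Import all_boot all_order all_algebra.
From mathcomp Require Import all_classical all_analysis.

(* The map [phi] is continuous on a comeager set [D], by the Baire property of
   Borel sets. If [Y] is k-step, the value of a (k+1)-cube at its top vertex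
   depends continuously on the other values, so it suffices to find, for [x']
   near [x], cubes with top vertex [x'] and all other values in [D], close to such
   a cube for [x]. These come from a Baire category argument on cubes, once
   a cube of [X] can be moved continuously: one vertex is perturbed while a face
   is fixed. That openness follows from the existence of corner completions with
   prescribed limit along an ultrafilter; the error of an arbitrary completion is
   pushed to higher and higher steps, until it vanishes. *)

Set Implicit Arguments.
Unset Strict Implicit.
Unset Printing Implicit Defensive.

Import GRing.Theory.

Local Open Scope classical_set_scope.
Local Open Scope ring_scope.

(** * Extending partial cubes *)

(** In integer coordinates a constant, [w i] and [~~ w i] are the affine functions b, x_i and 1 -
    x_i. Every cube morphism used below has this shape. *)
Lemma cube_morphism_coord (m n : nat) (f : cube m -> cube n) :
  (forall j, [\/ exists b, forall w, f w j = b,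
                 exists i, forall w, f w j = w i |
                 exists i, forall w, f w j = ~~ w i]) ->
  cube_morphism f.
Proof.
move=> fP.
have /choice[s sP] : forall j : 'I_n, exists s : ('I_m -> int) * int,
    forall w, (nat_of_bool (f w j))%:Z = \sum_i cube_int w 0 i * s.1 i + s.2.
  move=> j; have [[b bP]|[i iP]|[i iP]] := fP j.
  - exists (fun=> 0, (nat_of_bool b)%:Z) => w.
    by rewrite bP big1 ?add0r // => i _; rewrite mulr0.
  - exists (fun k => (k == i)%:R, 0) => w; rewrite addr0 (bigD1 i) //= big1.
      by rewrite iP mxE eqxx mulr1 addr0.
    by move=> k /negPf ->; rewrite mulr0.
  - exists (fun k => - (k == i)%:R, 1) => w; rewrite (bigD1 i) //= big1.
      by rewrite iP mxE eqxx addr0; case: (w i).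
    by move=> k /negPf ->; rewrite oppr0 mulr0.
exists (mulmxr (\matrix_(k, j) (s j).1 k)), (\row_j (s j).2) => w.
apply/rowP => j; rewrite !mxE sP; congr (_ + _).
by apply: eq_bigr => k _; rewrite !mxE.
Qed.

(** The retraction onto the face below [v]: [C (g \o cube_and v)] says that [g] is a cube on this
    face, without a parametrization of the face. *)
Definition cube_and (n : nat) (v w : cube n) : cube n := [ffun i => w i && v i].

Definition cube_le (n : nat) (v w : cube n) : bool := [forall i, v i ==> w i].

Definition upd (n : nat) (X : Type) (g : cube n -> X) (v : cube n) (z : X) :
  cube n -> X := fun w => if w == v then z else g w.

Lemma cube_and_morphism (n : nat) (v : cube n) : cube_morphism (cube_and v).
Proof.
apply: cube_morphism_coord => j; case vj : (v j).
  by apply: Or32; exists j => w; rewrite ffunE vj andbT.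
by apply: Or31; exists false => w; rewrite ffunE vj andbF.
Qed.

Lemma cube_and_le (n : nat) (v w : cube n) : cube_le (cube_and v w) v.
Proof. by apply/forallP => i; rewrite ffunE; case: (v i); case: (w i). Qed.

Lemma cube_and_id (n : nat) (v w : cube n) : cube_le w v -> cube_and v w = w.
Proof.
by move=> /forallP h; apply/ffunP => i; rewrite ffunE; move: (h i); case: (w i).
Qed.

Lemma cube_le_refl (n : nat) (v : cube n) : cube_le v v.
Proof. by apply/forallP => i; case: (v i). Qed.

Lemma cube_le_trans (n : nat) (v u w : cube n) :
  cube_le u v -> cube_le v w -> cube_le u w.
Proof.
move=> /forallP h /forallP k; apply/forallP => i; move: (h i) (k i).
by case: (u i); case: (v i).
Qed.

Lemma cube_le_one (n : nat) (v : cube n) : cube_le v (cube_one n).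
Proof. by apply/forallP => i; rewrite ffunE implybT. Qed.

Lemma cube_le_anti (n : nat) (v w : cube n) :
  cube_le v w -> cube_le w v -> v = w.
Proof.
move=> /forallP h /forallP k; apply/ffunP => i; move: (h i) (k i).
by case: (v i); case: (w i).
Qed.

Definition cube_weight (n : nat) (v : cube n) : nat := (\sum_i v i)%N.

Lemma cube_weight_lt (n : nat) (v w : cube n) :
  cube_le v w -> v != w -> (cube_weight v < cube_weight w)%N.
Proof.
move=> /forallP le ne.
have [i vi] : exists i, v i != w i.
  by apply/existsP; apply: contra_neqT ne => /existsPn h; apply/ffunP => i;
    apply/eqP; rewrite -[_ == _]negbK.
rewrite /cube_weight (bigD1 i) //= [ltnRHS](bigD1 i) //= -addSn leq_add //.
  by move: (le i) vi; case: (v i); case: (w i).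
by apply: leq_sum => j _; move: (le j); case: (v j); case: (w j).
Qed.

(* With trivial [rho] this is corner completion in [Z]. *)
Definition corner_lifting (Z B : Type) (CZ : cube_family Z) (CB : cube_family B)
    (rho : Z -> B -> Prop) : Prop :=
  forall (m : nat) (c : cube m.+1 -> B) (f : cube m.+1 -> Z),
    CB m.+1 c -> corner CZ f ->
    (forall w, w != cube_one m.+1 -> rho (f w) (c w)) ->
    exists z, rho z (c (cube_one m.+1)) /\ CZ m.+1 (upd f (cube_one m.+1) z).

Definition comp_closed (Z : Type) (CZ : cube_family Z) : Prop :=
  forall (m n : nat) (c : cube n -> Z) (f : cube m -> cube n),
    CZ n c -> cube_morphism f -> CZ m (c \o f).

Section lifting.
Variables (Z B : Type) (CZ : cube_family Z) (CB : cube_family B).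
Variable rho : Z -> B -> Prop.
Hypothesis (CZcomp : comp_closed CZ) (CBcomp : comp_closed CB).
Hypothesis lift : corner_lifting CZ CB rho.

(** The face below [v] is identified with a cube by [emb], with left inverse [proj]. Its top vertex
    is [v], so [lift] applies; its dimension is positive because [v] is not the origin. *)
Lemma lower_face_lifting (n : nat) (c : cube n -> B) (g : cube n -> Z)
    (v : cube n) :
  CB c -> v != [ffun=> false] ->
  (forall w, cube_le w v -> w != v -> rho (g w) (c w) /\ CZ (g \o cube_and w)) ->
  exists z, rho z (c v) /\ CZ (upd g v z \o cube_and v).
Proof.
move=> Cc v0 gP.
pose S := [set i | v i]%SET.
have [m mS] : exists m, #|S| = m.+1.
  case E : #|S| => [|m]; last by exists m.
  case/eqP: v0; apply/ffunP => i; rewrite ffunE.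
  by move/eqP: E; rewrite cards_eq0 => /eqP/setP/(_ i); rewrite !inE.
pose h (k : 'I_m.+1) : 'I_n := enum_val (cast_ord (esym mS) k).
have hinj : injective h by move=> k l /enum_val_inj/cast_ord_inj.
have hv k : v (h k) by have := enum_valP (cast_ord (esym mS) k); rewrite inE.
have hsurj i : v i -> exists k, h k = i.
  move=> vi; have iS : i \in S by rewrite inE.
  exists (cast_ord mS (enum_rank_in iS i)).
  by rewrite /h cast_ordK enum_rankK_in.
pose emb (w : cube m.+1) : cube n :=
  [ffun j => if [pick k | h k == j] is Some k then w k else false].
pose proj (u : cube n) : cube m.+1 := [ffun k => u (h k)].
have embh w k : emb w (h k) = w k.
  rewrite ffunE; case: pickP => [l /eqP/hinj -> //|/(_ k)]; by rewrite eqxx.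
have embv w j : ~~ v j -> emb w j = false.
  by move=> vj; rewrite ffunE; case: pickP => // k /eqP kj; rewrite -kj hv in vj.
have emb_mor : cube_morphism emb.
  apply: cube_morphism_coord => j; have [/hsurj [k <-]|vj] := boolP (v j).
    by apply: Or32; exists k => w; rewrite embh.
  by apply: Or31; exists false => w; rewrite embv.
have proj_mor : cube_morphism proj.
  apply: cube_morphism_coord => k; apply: Or32; exists (h k) => w.
  by rewrite ffunE.
have embproj u : emb (proj u) = cube_and v u.
  apply/ffunP => j; rewrite [RHS]ffunE; have [vj|vj] := boolP (v j).
    by have [k <-] := hsurj _ vj; rewrite embh ffunE andbT.
  by rewrite embv // andbF.
have emb_le w : cube_le (emb w) v.
  by apply/forallP => j; apply/implyP; apply: contraTT => /embv ->.
have emb1 : emb (cube_one _) = v.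
  apply/ffunP => j; have [vj|vj] := boolP (v j).
    by have [k <-] := hsurj _ vj; rewrite embh ffunE.
  by rewrite embv // (negPf vj).
have embinj : injective emb.
  by move=> w1 w2 e; apply/ffunP => k; rewrite -!embh e.
have emb_neq w : w != cube_one _ -> emb w != v.
  by apply: contra => /eqP e; apply/eqP/embinj; rewrite e emb1.
have [||w w1|z [rz Cz]] := @lift m (c \o emb) (g \o emb).
- exact: CBcomp.
(* The [k]-th lower face lies below [w'], which is [v] with its [k]-th one removed. *)
- move=> k; pose w' := emb [ffun l => l != k].
  have w'v : w' != v.
    by apply: emb_neq; apply/eqP => /ffunP/(_ k); rewrite !ffunE eqxx.
  have face_le w : emb (cube_face k w) = cube_and w' (emb (cube_face k w)).
    rewrite cube_and_id //; apply/forallP => j; have [vj|vj] := boolP (v j); last first.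
      by rewrite embv.
    have [l <-] := hsurj _ vj; rewrite !embh !ffunE.
    by case: unliftP => [l' ->|->]; rewrite ?eqxx // eq_sym neq_lift implybT.
  have -> : (g \o emb) \o cube_face k = (g \o cube_and w') \o (emb \o cube_face k).
    by apply/funext => w /=; rewrite -face_le.
  apply: CZcomp; first by have [] := gP w' (emb_le _) w'v.
  apply: cube_morphism_coord => j; have [vj|vj] := boolP (v j); last first.
    by apply: Or31; exists false => w /=; rewrite embv.
  have [l <-] := hsurj _ vj; case: (unliftP k l) => [l' ->|->].
    by apply: Or32; exists l' => w /=; rewrite embh ffunE liftK.
  by apply: Or31; exists false => w /=; rewrite embh ffunE unlift_none.
- by have [] := gP (emb w) (emb_le _) (emb_neq _ w1).
exists z; split; first by rewrite -emb1.
have -> : upd g v z \o cube_and v = upd (g \o emb) (cube_one _) z \o proj.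
  apply/funext => u; rewrite /upd /= -embproj.
  by rewrite -[in X in (_ == X)]emb1 (inj_eq embinj).
exact: CZcomp.
Qed.

(** Induction on the number of vertices off [S]. All vertices strictly below a lightest vertex [v]
    off [S] are in [S], so [v] can be filled; the faces below the old vertices of [S] do not contain
    [v]. Once [S] contains the top vertex, [f] itself is a cube. *)
Lemma downset_lifting (n : nat) (S : {set cube n}) (c : cube n -> B)
    (f : cube n -> Z) :
  CB c -> [ffun=> false] \in S ->
  (forall u v, v \in S -> cube_le u v -> u \in S) ->
  (forall v, v \in S -> rho (f v) (c v) /\ CZ (f \o cube_and v)) ->
  exists g, [/\ CZ g, forall v, v \in S -> g v = f v &
                forall v, rho (g v) (c v)].
Proof.
move=> Cc; have [k] := ubnP #|~: S|%SET.
elim: k => // k IH in S f *; rewrite ltnS => Sk S0 Sdown fP.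
have [S1|[v0 v0S]] : cube_one n \in S \/ exists v, v \notin S.
  by have [|] := boolP (cube_one n \in S); [left|right; exists (cube_one n)].
- have inS v : v \in S by apply: Sdown (cube_le_one v).
  exists f; split=> // [|v]; last by have [] := fP v (inS v).
  have [_] := fP _ S1; congr CZ; apply/funext => w /=.
  by rewrite cube_and_id // cube_le_one.
case: (@arg_minnP _ v0 (fun u => u \notin S) (@cube_weight n) v0S) => v vS vmin.
have ltS u : cube_le u v -> u != v -> u \in S.
  move=> uv ne; apply: contraT => /vmin.
  by rewrite leqNgt cube_weight_lt.
have vn0 : v != [ffun=> false] by apply: contraNneq vS => ->.
have [z [rz Cz]] := lower_face_lifting Cc vn0 (fun w l n => fP w (ltS w l n)).
have [|||u|g [Cg gS gr]] := IH (v |: S)%SET (upd f v z).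
- apply: leq_trans Sk; apply: proper_card; apply/properP; split.
    by apply/fintype.subsetP => u; rewrite !inE negb_or => /andP[].
  by exists v; rewrite !inE ?eqxx.
- by rewrite !inE S0 orbT.
- move=> u w; rewrite !inE => /orP[/eqP ->|wS] uw.
    by have [->//|uv] := eqVneq u v; rewrite (ltS u).
  by rewrite (Sdown u w) ?orbT.
- rewrite !inE; have [-> _|uv /= uS] := eqVneq u v.
    by rewrite /upd eqxx.
  rewrite {1}/upd (negPf uv); have [ru Cu] := fP u uS; split => //.
  suff -> : upd f v z \o cube_and u = f \o cube_and u by [].
  apply/funext => w; rewrite /upd /=; case: eqP => // wv.
  by move: vS; rewrite -wv (Sdown _ u) ?cube_and_le.
exists g; split=> // w wS; rewrite gS ?inE ?wS ?orbT // /upd.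
by case: eqP => // wv; rewrite -wv wS in vS.
Qed.

End lifting.

(** * Nilspaces *)

Definition set_coord (n : nat) (w : cube n) (i : 'I_n) (b : bool) : cube n :=
  [ffun l => if l == i then b else w l].

(** For n > 0, [C (top_cube n a b)] is the canonical relation of order n - 1 on a nilspace: it
    measures how two completions of one corner can differ. *)
Definition top_cube (X : Type) (n : nat) (a b : X) : cube n -> X :=
  upd (fun=> a) (cube_one n) b.

Arguments top_cube {X} n a b.

Section nilspace_theory.
Variables (X : Type) (C : cube_family X).
Hypothesis hC : nilspace C.

Let Ccomp : comp_closed C.
Proof. exact: cubespace_comp (nilspace_cubespace hC). Qed.

Lemma completion_upd (n : nat) (f : cube n.+1 -> X) :
  corner C f -> exists z, C (upd f (cube_one n.+1) z).
Proof.
move=> /(nilspace_corner hC)[c [Cc cf]]; exists (c (cube_one _)).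
suff -> : upd f (cube_one _) (c (cube_one _)) = c by [].
by apply/funext => w; rewrite /upd; case: eqVneq => [->//|/cf ->].
Qed.

Lemma cube_edge (n : nat) (i : 'I_n) (h : bool -> X) : C (fun w : cube n => h (w i)).
Proof.
have -> : (fun w : cube n => h (w i)) =
    (fun w : cube 1 => h (w ord0)) \o (fun w : cube n => [ffun=> w i]).
  by apply/funext => w /=; rewrite ffunE.
apply: Ccomp; first by rewrite (nilspace_ergodic hC).
by apply: cube_morphism_coord => j; apply: Or32; exists i => w; rewrite ffunE.
Qed.

Lemma cube_const (n : nat) (a : X) : C (fun _ : cube n => a).
Proof.
have -> : (fun _ : cube n => a) = (fun _ : cube 0 => a) \o (fun=> [ffun=> false]).
  by [].
apply: Ccomp; first by rewrite (cubespace0 (nilspace_cubespace hC)).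
by apply: cube_morphism_coord => -[].
Qed.

(** Two adjacent lower faces of an (n+1)-cube carry [c1] and a reflected [c2]. This partial cube
    extends, and a diagonal of the extension is the concatenation. *)
Lemma cube_concat (n : nat) (i : 'I_n) (c1 c2 : cube n -> X) :
  C c1 -> C c2 ->
  (forall w : cube n, ~~ w i -> c1 w = c2 (set_coord w i true)) ->
  C (fun w : cube n => if w i then c1 w else c2 w).
Proof.
move=> C1 C2 c12.
pose tl (W : cube n.+1) : cube n := [ffun l => W (lift ord0 l)].
pose f (W : cube n.+1) := if W ord0 then c2 (tl W) else c1 (tl W).
pose S := [set W : cube n.+1 | ~~ W ord0 || ~~ W (lift ord0 i)]%SET.
have [||||||g [Cg gS _]] := @downset_lifting _ unit C (fun n => setT)
  (fun _ _ => True) Ccomp _ _ _ S (fun=> tt) f.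
- by [].
- move=> m c f' _ /completion_upd[z Cz] _; by exists z.
- by [].
- by rewrite inE ffunE.
- move=> u v; rewrite !inE => vS /forallP uv.
  by move: vS (uv ord0) (uv (lift ord0 i)); do 4 case: (_ (_ : 'I_n.+1)).
- move=> v; rewrite inE => vS; split=> //.
  have [v0|v0] := boolP (v ord0); last first.
    have -> : f \o cube_and v = c1 \o (tl \o cube_and v).
      by apply/funext => W /=; rewrite /f ffunE (negPf v0) andbF.
    apply: Ccomp => //; apply: cube_morphism_coord => j.
    case vj : (v (lift ord0 j)).
      by apply: Or32; exists (lift ord0 j) => W; rewrite /= !ffunE vj andbT.
    by apply: Or31; exists false => W; rewrite /= !ffunE vj andbF.
  rewrite v0 /= in vS.
  have -> : f \o cube_and v =
      c2 \o (fun W : cube n.+1 => set_coord (tl (cube_and v W)) i (~~ W ord0)).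
    apply/funext => W /=; rewrite /f {1}ffunE v0 andbT; case: (W ord0) => /=.
      congr c2; apply/ffunP => l; rewrite [RHS]ffunE; case: eqP => // ->.
      by rewrite !ffunE (negPf vS) andbF.
    by rewrite c12 // !ffunE (negPf vS) andbF.
  apply: Ccomp => //; apply: cube_morphism_coord => j.
  case: (eqVneq j i) => [->|ji].
    by apply: Or33; exists ord0 => W; rewrite !ffunE eqxx.
  case vj : (v (lift ord0 j)).
    by apply: Or32; exists (lift ord0 j) => W; rewrite !ffunE (negPf ji) vj andbT.
  by apply: Or31; exists false => W; rewrite !ffunE (negPf ji) vj andbF.
(* The diagonal on which the new coordinate is the negation of coordinate [i]; it stays inside
   [S]. *)
pose e (w : cube n) : cube n.+1 :=
  [ffun j => if unlift ord0 j is Some l then w l else ~~ w i].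
have tle w : tl (e w) = w by apply/ffunP => l; rewrite !ffunE liftK.
have -> : (fun w : cube n => if w i then c1 w else c2 w) = g \o e.
  apply/funext => w /=; rewrite gS.
    by rewrite /f tle ffunE unlift_none; case: (w i).
  by rewrite inE !ffunE unlift_none liftK; case: (w i).
apply: Ccomp => //; apply: cube_morphism_coord => j.
case: (unliftP ord0 j) => [l ->|->].
  by apply: Or32; exists l => w; rewrite ffunE liftK.
by apply: Or33; exists i => w; rewrite ffunE unlift_none.
Qed.

(* Fold [{1, 0, -1}] to [{true, x, y}] in each coordinate. All the unit cells of
   the folded [d] on [{1, 0, -1}^n] are cubes; concatenating them one direction at
   a time pushes the replaced value [b] from the cell [{1, 0}^n] to the outer
   cube [{1, -1}^n]. *)
Lemma cube_refold (n : nat) (d : cube n -> X) (b : X) (x y : bool) :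
  C d ->
  C (upd (fun w : cube n => d [ffun i => w i || x]) (cube_one n) b) ->
  C (upd (fun w : cube n => d [ffun i => w i || y]) (cube_one n) b).
Proof.
move=> Cd C0.
(* At stage [r] the first [r] directions have been moved from [x] to [y]. *)
pose u (r : nat) (w : cube n) : cube n :=
  [ffun i : 'I_n => w i || (if (i < r)%N then y else x)].
have CE r : (r <= n)%N -> C (upd (d \o u r) (cube_one n) b).
  elim: r => [_|r IH rn].
    by have -> : d \o u 0%N = fun w : cube n => d [ffun i => w i || x].
  pose i := Ordinal rn.
  (* The neighbouring cell in direction [i]: there its coordinate runs from [y] to [x], and at [x]
     it meets the lower face of the current cell. *)
  pose u' (w : cube n) : cube n := [ffun l : 'I_n =>
     if l == i then (if w i then x else y) else w l || (if (l < r)%N then y else x)].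
  have nrE l : l != i -> (l < r.+1)%N = (l < r)%N.
    move=> li; rewrite ltnS leq_eqVlt orb_idl // => /eqP lr.
    by case/eqP: li; apply: val_inj.
  have one_i (w : cube n) : ~~ w i -> (w == cube_one n) = false.
    by apply: contraNF => /eqP ->; rewrite ffunE.
  have -> : upd (d \o u r.+1) (cube_one n) b =
      fun w => if w i then upd (d \o u r) (cube_one n) b w else (d \o u') w.
    apply/funext => w; case: ifP => wi.
      rewrite /upd; case: eqP => //= _; congr d; apply/ffunP => l; rewrite !ffunE.
      by have [->|/nrE ->//] := eqVneq l i; rewrite wi.
    rewrite /upd one_i ?wi //=; congr d; apply/ffunP => l; rewrite !ffunE.
    by have [->|/nrE ->//] := eqVneq l i; rewrite wi ltnSn.
  apply: cube_concat => [||w wi]; first exact/IH/ltnW.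
    apply: Ccomp => //; apply: cube_morphism_coord => l; case: (eqVneq l i) => [->|li].
      have : forall w, u' w i = if w i then x else y by move=> w; rewrite ffunE eqxx.
      case: (x); case: (y) => u'i.
      - by apply: Or31; exists true => w; rewrite u'i; case: (w i).
      - by apply: Or32; exists i => w; rewrite u'i; case: (w i).
      - by apply: Or33; exists i => w; rewrite u'i; case: (w i).
      - by apply: Or31; exists false => w; rewrite u'i; case: (w i).
    case E : (if (l < r)%N then y else x).
      by apply: Or31; exists true => w; rewrite ffunE (negPf li) E orbT.
    by apply: Or32; exists l => w; rewrite ffunE (negPf li) E orbF.
  rewrite /upd one_i //=; congr d; apply/ffunP => l; rewrite !ffunE eqxx.
  by case: eqP => [->|//]; rewrite (negPf wi) ltnn.
have := CE n (leqnn n); congr (C _); congr upd; apply/funext => w /=.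
by congr d; apply/ffunP => i; rewrite !ffunE ltn_ord.
Qed.

(** Refolding [d] from [x = false] to [y = true]: the inner cell is [c], while in the outer cube
    every vertex folds to the top vertex of [d]. *)
Lemma top_cube_of_completions (n : nat) (c d : cube n -> X) :
  C c -> C d -> (forall w, w != cube_one n -> c w = d w) ->
  C (top_cube n (d (cube_one n)) (c (cube_one n))).
Proof.
move=> Cc Cd cd.
have := @cube_refold n d (c (cube_one n)) false true Cd.
have -> : upd (fun w : cube n => d [ffun i => w i || false]) (cube_one n)
    (c (cube_one n)) = c.
  apply/funext => w; rewrite /upd; case: eqVneq => [->//|/cd ->].
  by congr d; apply/ffunP => i; rewrite ffunE orbF.
move=> /(_ Cc); congr (C _); congr upd; apply/funext => w /=.
by congr d; apply/ffunP => i; rewrite !ffunE orbT.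
Qed.

(** The same refolding in the opposite direction, from [x = true] to [y = false]. *)
Lemma replace_top (n : nat) (e : cube n -> X) (b : X) :
  C e -> C (top_cube n (e (cube_one n)) b) -> C (upd e (cube_one n) b).
Proof.
move=> Ce Cb; have := @cube_refold n e b true false Ce.
have -> : upd (fun w : cube n => e [ffun i => w i || true]) (cube_one n) b =
    top_cube n (e (cube_one n)) b.
  congr upd; apply/funext => w /=.
  by congr e; apply/ffunP => i; rewrite !ffunE orbT.
move=> /(_ Cb); congr (C _); congr upd; apply/funext => w /=.
by congr e; apply/ffunP => i; rewrite ffunE orbF.
Qed.

(** The m-cube embeds as the face where the remaining coordinates are 1; only its top vertex goes to
    the top vertex. *)
Lemma top_cube_anti (m n : nat) (a b : X) :
  (m <= n)%N -> C (top_cube n a b) -> C (top_cube m a b).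
Proof.
move=> mn Cn.
pose e (w : cube m) : cube n :=
  [ffun j : 'I_n => if insub (val j) is Some i then w i else true].
have e1 w : (e w == cube_one n) = (w == cube_one m).
  apply/eqP/eqP => [ew|->].
    apply/ffunP => i; move/ffunP: ew => /(_ (widen_ord mn i)).
    by rewrite !ffunE /= valK.
  by apply/ffunP => j; rewrite !ffunE; case: insubP => // i _ _; rewrite ffunE.
have -> : top_cube m a b = top_cube n a b \o e.
  by apply/funext => w; rewrite /top_cube /upd /= e1.
apply: Ccomp => //; apply: cube_morphism_coord => j.
case E : (insub (val j) : option 'I_m) => [i|].
  by apply: Or32; exists i => w; rewrite ffunE E.
by apply: Or31; exists true => w; rewrite ffunE E.
Qed.

(** The constant cube and [top_cube] complete the same corner. *)
Lemma step_top_cube (k : nat) (a b : X) :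
  step C k -> C (top_cube k.+1 a b) -> a = b.
Proof.
move=> stepC Cab; have [|c [_ cuniq]] := stepC (fun=> a).
  by move=> i; exact: cube_const.
have -> : a = c (cube_one k.+1).
  rewrite (cuniq (fun=> a)) //; split=> //; exact: cube_const.
rewrite (cuniq (top_cube k.+1 a b)) ?/top_cube ?/upd ?eqxx //.
by split=> // w /negPf w1; rewrite w1.
Qed.

End nilspace_theory.

(** * Completions with a prescribed limit *)

Lemma compact_ultra_cvg (I : Type) (X : topologicalType) (U : set_system I)
    (f : I -> X) :
  UltraFilter U -> compact [set: X] -> exists x : X, f @ U --> x.
Proof.
move=> UU cX; have [|x [_ xP]] := cX (f @ U) _; first exact: filterT.
exists x => N xN; have [//|Uc] := in_ultra_setVsetC (f @^-1` N) UU.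
have [y [ny Ny]] := xP (~` N) N Uc xN.
by have := ny Ny.
Qed.

Lemma cvg_coordinatewise (I V : Type) (X : topologicalType) (F : set_system I)
    (c : I -> V -> X) (c0 : V -> X) :
  Filter F -> (forall v, (c^~ v) @ F --> c0 v) ->
  (c : I -> prod_topology (fun _ : V => X)) @ F -->
    (c0 : prod_topology (fun _ : V => X)).
Proof.
move=> FF cv; apply/cvg_sup => v N.
rewrite (@nbhsE (initial_topology (fun f : V -> X => f v))).
case=> _ [[G oG <-] Gc0] /filterS; apply.
by apply: (cv v); apply: open_nbhs_nbhs; split.
Qed.

Lemma cube_face_morphism (n : nat) (i : 'I_n.+1) : cube_morphism (@cube_face n i).
Proof.
apply: cube_morphism_coord => j; case: (unliftP i j) => [l ->|->].
  by apply: Or32; exists l => w; rewrite ffunE liftK.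
by apply: Or31; exists false => w; rewrite ffunE unlift_none.
Qed.

Section compact_nilspace_theory.
Variables (X : topologicalType) (C : cube_family X).
Hypothesis hX : compact_nilspace C.

Let hC : nilspace C := compact_nilspace_nilspace hX.

Let Ccomp : comp_closed C.
Proof. exact: cubespace_comp (nilspace_cubespace hC). Qed.

Lemma cube_limit (I : Type) (F : set_system I) (n : nat)
    (c : I -> cube n -> X) (c0 : cube n -> X) :
  ProperFilter F -> (\forall i \near F, C (c i)) ->
  (forall v, (c^~ v) @ F --> c0 v) -> C c0.
Proof.
move=> FF Cc cv.
have := (@closed_cvg I (prod_topology (fun _ : cube n => X)) F _ c (@C n)
  (compact_nilspace_closed hX (n := n)) Cc c0).
apply; exact: cvg_coordinatewise.
Qed.

Section ultralimit.
Variables (k : nat) (I : Type) (U : set_system I).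
Hypotheses (stepC : step C k) (UU : UltraFilter U).

(** Indexed families of cubes, so that a lifting along convergence extends all partial cubes of a
    family at once and controls their limit. *)
Let CI : cube_family (I -> X) := fun n c => forall i, C (fun v => c v i).

(* Start from arbitrary completions, whose limit [a] satisfies
   [top_cube n a b] for the required limit [b], and correct them until
   [top_cube p a b] holds for a [p] so large that it forces [a = b]. The
   correction completes the corner [(a, .., a, b)] [(z i, .., z i, ?)]. *)
Lemma ultralimit_lifting : corner_lifting CI C (fun z x => z @ U --> x).
Proof.
move=> m c f Cc Cf fc; set b := c (cube_one m.+1).
(* The induction on [p] starts at the dimension [m.+1] of the corner and must reach at least [k.+1],
   where [step_top_cube] forces equality. *)
have [p [mp kp]] : exists p, (m < p)%N /\ (k < p)%N.
  by exists (m + k).+1; rewrite !ltnS leq_addr leq_addl.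
suff [z [a [Cz za Ca]]] : exists z a,
    [/\ forall i, C (upd (f^~ i) (cube_one _) (z i)), z @ U --> a &
        C (top_cube p a b)].
  exists z; have <- : a = b := step_top_cube hC stepC (top_cube_anti hC kp Ca).
  split=> // i; have := Cz i; congr (C _); apply/funext => w.
  by rewrite /upd; case: eqP.
elim: p mp {kp} => // p IH; rewrite ltnS leq_eqVlt => /predU1P[<-|mp].
  have /choice[z Cz] i : exists z, C (upd (f^~ i) (cube_one m.+1) z).
    by apply: completion_upd => // j; have := Cf j i.
  have [a za] := compact_ultra_cvg z UU (compact_nilspace_compact hX).
  exists z, a; split=> //.
  have Cd : C (upd c (cube_one _) a).
    apply: (@cube_limit _ U _ (fun i => upd (f^~ i) (cube_one m.+1) (z i))).
      exact: nearW.
    by move=> v; rewrite /upd; have [//|/fc] := eqVneq v (cube_one _).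
  have := @top_cube_of_completions _ _ hC _ c _ Cc Cd.
  by rewrite {2}/upd eqxx; apply => w; rewrite /upd => /negPf ->.
have [z [a [Cz za Ca]]] := IH mp.
pose tl (W : cube p.+1) : cube p := [ffun l => W (lift ord0 l)].
pose q (x : X) (W : cube p.+1) := if W ord0 then x else top_cube p a b (tl W).
have tl1 (W : cube p.+1) : W ord0 -> (tl W == cube_one p) = (W == cube_one p.+1).
  move=> W0; apply/eqP/eqP => [/ffunP tW|->].
    apply/ffunP => j; rewrite [RHS]ffunE; case: (unliftP ord0 j) => [l ->|->//].
    by have := tW l; rewrite !ffunE.
  by apply/ffunP => l; rewrite !ffunE.
have corner_q x : corner C (q x).
  move=> j; case: (unliftP ord0 j) => [l ->|->]; last first.
    have -> : q x \o cube_face ord0 = top_cube p a b.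
      apply/funext => w; rewrite /q /= ffunE unlift_none; congr top_cube.
      by apply/ffunP => l; rewrite !ffunE liftK.
    exact: Ca.
  (* The value [b] sits over the top vertex of the p-cube, which this face misses; what remains is
     an edge from [a] to [x]. *)
  have -> : q x \o cube_face (lift ord0 l) =
      (fun W : cube p.+1 => if W ord0 then x else a) \o cube_face (lift ord0 l).
    apply/funext => w; rewrite /q /=; case: ifP => // _.
    rewrite /top_cube /upd; case: eqP => // /ffunP/(_ l).
    by rewrite !ffunE unlift_none.
  apply: Ccomp (cube_face_morphism _).
  exact: (cube_edge hC ord0 (fun t => if t then x else a)).
have /choice[y Cy] i : exists y, C (upd (q (z i)) (cube_one p.+1) y).
  exact: completion_upd.
have [b' yb'] := compact_ultra_cvg y UU (compact_nilspace_compact hX).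
exists y, b'; split=> // [i|].
  have top_z : upd (f^~ i) (cube_one m.+1) (z i) (cube_one m.+1) = z i.
    by rewrite /upd eqxx.
  (* The upper face of the completed corner. Since [m < p], it allows [z i] to be replaced by [y i]
     on top of the original cube. *)
  have Czy : C (top_cube p (z i) (y i)).
    have -> : top_cube p (z i) (y i) = upd (q (z i)) (cube_one p.+1) (y i) \o
        (fun w : cube p => [ffun j => if unlift ord0 j is Some l then w l else true]).
      apply/funext => w; rewrite /top_cube /upd /= -tl1 ?ffunE ?unlift_none //.
      have -> : tl [ffun j => if unlift ord0 j is Some l then w l else true] = w.
        by apply/ffunP => l; rewrite !ffunE liftK.
      by case: eqP => // _; rewrite /q ffunE unlift_none.
    apply: Ccomp => //; apply: cube_morphism_coord => j.
    case: (unliftP ord0 j) => [l ->|->].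
      by apply: Or32; exists l => w; rewrite ffunE liftK.
    by apply: Or31; exists true => w; rewrite ffunE unlift_none.
  have := @replace_top _ _ hC _ _ (y i) (Cz i); rewrite top_z.
  move=> /(_ (top_cube_anti hC mp Czy)); congr (C _); apply/funext => w.
  by rewrite /upd; case: eqP.
(* The limit of the completed corners. Off the top it agrees with [top_cube p a b \o tl], whose top
   value is [b]; hence [b'] and [b] are related one order higher. *)
have Cd : C (upd (q a) (cube_one p.+1) b').
  apply: (@cube_limit _ U _ (fun i => upd (q (z i)) (cube_one p.+1) (y i))).
    exact: nearW.
  move=> W; rewrite /upd; case: eqP => // _; rewrite /q.
  by case: ifP => // _; exact: cvg_cst.
have vd : upd (q a) (cube_one p.+1) b' (cube_one p.+1) = b' by rewrite /upd eqxx.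
have vc : (top_cube p a b \o tl) (cube_one p.+1) = b.
  by rewrite /top_cube /upd /= tl1 ?ffunE ?eqxx.
have := @top_cube_of_completions _ _ hC _ (top_cube p a b \o tl) _ _ Cd.
rewrite vd vc; apply.
  apply: Ccomp => //; apply: cube_morphism_coord => j; apply: Or32.
  by exists (lift ord0 j) => W; rewrite ffunE.
move=> W W1; rewrite /upd (negPf W1) /q /=; case: ifP => // W0.
by rewrite /top_cube /upd tl1 // (negPf W1).
Qed.

End ultralimit.
End compact_nilspace_theory.

(** * Moving cubes *)

(** Reflection in the coordinates where [s] is 1; it brings the vertex to be moved into the position
    required by [cube_move]. *)
Definition cube_xor (n : nat) (s w : cube n) : cube n := [ffun i => w i (+) s i].

Lemma cube_xor_morphism (n : nat) (s : cube n) : cube_morphism (cube_xor s).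
Proof.
apply: cube_morphism_coord => j; case sj : (s j).
  by apply: Or33; exists j => w; rewrite ffunE sj addbT.
by apply: Or32; exists j => w; rewrite ffunE sj addbF.
Qed.

Lemma cube_xorK (n : nat) (s : cube n) : involutive (cube_xor s).
Proof. by move=> w; apply/ffunP => i; rewrite !ffunE addbK. Qed.

Section compact_finite_step.
Variables (X : topologicalType) (C : cube_family X) (k : nat).
Hypotheses (hX : compact_nilspace C) (stepC : step C k).

Let hC : nilspace C := compact_nilspace_nilspace hX.

Let Ccomp : comp_closed C.
Proof. exact: cubespace_comp (nilspace_cubespace hC). Qed.

(* Otherwise an ultrafilter of values [y] converging to [c e] is made of bad
   values, while [ultralimit_lifting] extends the partial cubes with value [y]
   at [e] and [c] off the upper cone of [e] to cubes that converge to [c]. *)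
Lemma cube_move (n : nat) (i : 'I_n) (e : cube n) (c : cube n -> X)
    (V : cube n -> set X) :
  (forall l, l != i -> ~~ e l) -> C c -> (forall w, nbhs (c w) (V w)) ->
  \forall y \near c e, exists c', [/\ C c', c' e = y,
    forall u, ~~ cube_le e u -> c' u = c u & forall w, V w (c' w)].
Proof.
move=> ei Cc Vc.
pose Good := [set y | exists c', [/\ C c', c' e = y,
  forall u, ~~ cube_le e u -> c' u = c u & forall w, V w (c' w)]].
apply: (contrapT (P := nbhs (c e) Good)) => nGood.
have Fproper : ProperFilter (within (~` Good) (nbhs (c e))).
  split; last exact: within_filter.
  move=> F0; have {}F0 : \forall y \near c e, ~ Good y -> False := F0.
  by apply: nGood; apply: filterS F0 => y; exact: contrapT.
have [U [UU FU]] := ultraFilterLemma Fproper.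
have Uc : id @ U --> c e.
  by move=> N Nc; apply: FU; exact: (@filterS _ (nbhs (c e)) _ N).
have UnGood : U (~` Good) by apply: FU; exact: withinT.
pose S := [set u : cube n | (u == e) || ~~ cube_le e u]%SET.
pose f (u : cube n) (y : X) := if u == e then y else c u.
have fc v : f v @ U --> c v.
  by rewrite /f; have [->//|_] := eqVneq v e; exact: cvg_cst.
have [||||g [Cg gS gc]] := downset_lifting _ Ccomp
    (@ultralimit_lifting _ _ hX k X U stepC UU) (S := S) (f := f) Cc.
- by move=> m p c' h Cc' hm y; exact: Ccomp (Cc' y) hm.
- rewrite inE; case: eqVneq => //= e0; apply: contraNN e0 => /forallP e0.
  by apply/eqP/ffunP => l; have := e0 l; rewrite !ffunE; case: (e l).
- move=> u v; rewrite !inE => /orP[/eqP ->|nev] uv.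
    have [//|ue /=] := eqVneq u e.
    by apply: contra ue => eu; apply/eqP/cube_le_anti.
  by apply/orP; right; apply: contra nev => eu; exact: cube_le_trans uv.
- move=> v; rewrite inE => vS; split=> // y.
  (* The face below [e] is a point or an edge, so by ergodicity any value [y] is allowed at [e]. *)
  have [ev|nev] := eqVneq v e.
    have [ei'|/negPf ei'] := boolP (e i); last first.
      have -> : (fun w => (f \o cube_and v) w y) = (fun _ : cube n => y).
        apply/funext => w; rewrite /f /= ifT //; apply/eqP/ffunP => l.
        rewrite !ffunE ev; have [->|/ei/negPf ->] := eqVneq l i; last by rewrite andbF.
        by rewrite ei' andbF.
      exact: cube_const.
    have := cube_edge hC i (fun t => if t then y else c [ffun=> false]).
    congr (C _); apply/funext => w; rewrite /f /= ev; case: ifP => wi.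
      rewrite ifT //; apply/eqP/ffunP => l; rewrite !ffunE.
      by have [->|/ei/negPf ->] := eqVneq l i; [rewrite wi|rewrite andbF].
    have -> : cube_and e w = [ffun=> false].
      apply/ffunP => l; rewrite !ffunE.
      by have [->|/ei/negPf ->] := eqVneq l i; [rewrite wi|rewrite andbF].
    rewrite ifF //; apply/eqP => /ffunP/(_ i); by rewrite ffunE ei'.
  rewrite (negPf nev) /= in vS.
  have -> : (fun w => (f \o cube_and v) w y) = c \o cube_and v.
    apply/funext => w; rewrite /f /=; case: eqP => // ve.
    by move: vS; rewrite -ve cube_and_le.
  exact: Ccomp (cube_and_morphism _).
have : \forall y \near U, forall w, V w (g w y).
  by apply: filter_forall => w; exact: gc (Vc w).
move=> UV; have [y [Vy]] := filter_ex (filterI UV UnGood); apply.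
exists (g^~ y); split=> //.
  by rewrite gS ?inE ?eqxx // /f eqxx.
move=> u eu; rewrite gS ?inE ?eu ?orbT // /f ifF //.
by apply: contraNF eu => /eqP ->; exact: cube_le_refl.
Qed.

(** Reflecting all coordinates turns the top vertex into the origin. *)
Lemma cube_move_top (n : nat) (c : cube n.+1 -> X) (V : cube n.+1 -> set X) :
  C c -> (forall w, nbhs (c w) (V w)) ->
  \forall y \near c (cube_one n.+1), exists c',
    [/\ C c', c' (cube_one n.+1) = y & forall w, V w (c' w)].
Proof.
move=> Cc Vc; pose s := cube_one n.+1; pose e : cube n.+1 := [ffun=> false].
have se : cube_xor s e = s by apply/ffunP => l; rewrite !ffunE.
have := @cube_move n.+1 ord0 e (c \o cube_xor s) (V \o cube_xor s).
rewrite /= se => H; apply: filterS (H _ _ _) => [y|l _||w].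
- move=> [c' [Cc' c'e _ Vc']]; exists (c' \o cube_xor s); split.
  + exact: Ccomp (cube_xor_morphism _).
  + by rewrite /= -(canRL (cube_xorK s) se).
  + by move=> w; have := Vc' (cube_xor s w); rewrite /= cube_xorK.
- by rewrite ffunE.
- exact: Ccomp (cube_xor_morphism _).
- exact: Vc.
Qed.

Lemma cube_move_vertex (n : nat) (v : cube n) (c : cube n -> X)
    (V : cube n -> set X) :
  v != cube_one n -> C c -> (forall w, nbhs (c w) (V w)) ->
  \forall y \near c v, exists c',
    [/\ C c', c' v = y, c' (cube_one n) = c (cube_one n) & forall w, V w (c' w)].
Proof.
move=> v1 Cc Vc.
have [i vi] : exists i, ~~ v i.
  apply/existsP; apply: contra_neqT v1 => /existsPn h; apply/ffunP => i.
  by rewrite ffunE; apply/negPn.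
(* Reflection by [s] exchanges [v] with the unit vector [e] and sends the top vertex to one with
   coordinate [i] zero, hence off the upper cone of [e], where nothing moves. *)
pose s := set_coord v i true; pose e : cube n := [ffun l => l == i].
have se : cube_xor s e = v.
  apply/ffunP => l; rewrite !ffunE; have [->|//] := eqVneq l i.
  by rewrite (negPf vi).
have := @cube_move n i e (c \o cube_xor s) (V \o cube_xor s).
rewrite /= se => H; apply: filterS (H _ _ _) => [y|l li||w].
- move=> [c' [Cc' c'e c'u Vc']]; exists (c' \o cube_xor s); split.
  + exact: Ccomp (cube_xor_morphism _).
  + by rewrite /= -(canRL (cube_xorK s) se).
  + rewrite /= c'u ?cube_xorK //; apply/forallPn; exists i.
    by rewrite !ffunE eqxx.
  + by move=> w; have := Vc' (cube_xor s w); rewrite /= cube_xorK.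
- by rewrite ffunE.
- exact: Ccomp (cube_xor_morphism _).
- exact: Vc.
Qed.

(** The vertices are moved into [D] one at a time: density provides the new value, and openness
    keeps the vertices treated before inside [D]. *)
Lemma cube_dense_open (n : nat) (D : set X) (c : cube n -> X)
    (V : cube n -> set X) :
  open D -> dense D -> C c -> (forall w, open (V w) /\ V w (c w)) ->
  exists c', [/\ C c', c' (cube_one n) = c (cube_one n), forall w, V w (c' w) &
    forall w, w != cube_one n -> D (c' w)].
Proof.
move=> oD dD Cc Vc.
suff [c' [Cc' c'1 Vc' Dc']] : exists c', [/\ C c',
    c' (cube_one n) = c (cube_one n), forall w, V w (c' w) &
    forall w, w \in enum {: cube n} -> w != cube_one n -> D (c' w)].
  by exists c'; split=> // w; apply: Dc'; rewrite mem_enum.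
elim: (enum _) => [|v s [c' [Cc' c'1 Vc' Dc']]].
  by exists c; split=> // w; have [] := Vc w.
have [->|v1] := eqVneq v (cube_one n).
  exists c'; split=> // w; rewrite inE => /predU1P[->|]; first by rewrite eqxx.
  exact: Dc'.
pose V' w := V w `&` [set x | (w \in s) && (w != cube_one n) -> D x].
have V'c w : nbhs (c' w) (V' w).
  apply: filterI; first by apply: open_nbhs_nbhs; split=> //; have [] := Vc w.
  have [/andP[ws w1]|ns] := boolP ((w \in s) && (w != cube_one n)).
    by apply: filterS (open_nbhs_nbhs (conj oD (Dc' w ws w1))) => x Dx _.
  exact: nearW.
have /nbhs_interior/= := cube_move_vertex v1 Cc' V'c.
set N := (X in nbhs _ X) => Nv.
have [||y [Ny Dy]] := dD N.
- by exists (c' v); exact: nbhs_singleton.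
- exact: open_interior.
have [c2 [Cc2 c2v c21 Vc2]] := interior_subset Ny.
exists c2; split=> //; first by rewrite c21.
  by move=> w; have [] := Vc2 w.
move=> w; rewrite inE => /predU1P[->|ws w1]; first by rewrite c2v.
by have [_] := Vc2 w; apply; rewrite ws.
Qed.

Lemma open_shrink (x : X) (W : set X) : open W -> W x ->
  exists V, [/\ open V, V x & closure V `<=` W].
Proof.
move=> oW Wx.
have reg : {for x, regular_space X}.
  apply: compact_regular (compact_nilspace_hausdorff hX)
    (compact_nilspace_compact hX) _; exact: filterT.
have [N Nx NW] := reg _ (open_nbhs_nbhs (conj oW Wx)).
exists N°; split; first exact: open_interior.
  exact: nbhs_singleton (nbhs_interior Nx).
exact: subset_trans (closure_subset (@interior_subset _ N)) NW.
Qed.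

(** Baire's argument with the top vertex fixed: cubes are moved into [D 0], [D 1], ... inside
    neighbourhoods with nested closures. A limit of these cubes is a cube because [C n] is
    closed. *)
Lemma cube_generic (n : nat) (D : nat -> set X) (c : cube n -> X)
    (V : cube n -> set X) :
  (forall m, open (D m) /\ dense (D m)) -> C c ->
  (forall w, open (V w) /\ V w (c w)) ->
  exists c', [/\ C c', c' (cube_one n) = c (cube_one n),
    forall w, w != cube_one n -> V w (c' w) &
    forall w m, w != cube_one n -> D m (c' w)].
Proof.
move=> DP Cc Vc.
pose inv (p : (cube n -> X) * (cube n -> set X)) :=
  [/\ C p.1, p.1 (cube_one n) = c (cube_one n) &
      forall w, open (p.2 w) /\ p.2 w (p.1 w)].
pose St := {p | inv p}.
have /choice[next nextP] : forall mp : nat * St, exists q : St,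
    forall w, w != cube_one n ->
      closure ((sval q).2 w) `<=` (sval mp.2).2 w `&` D mp.1.
  move=> [m [[c0 V0] /= [C0 c01 V0c]]].
  have [oD dD] := DP m.
  have [c' [Cc' c'1 Vc' Dc']] := cube_dense_open oD dD C0 V0c.
  have /choice[V' V'P] : forall w, exists V', [/\ open V', V' (c' w) &
      w != cube_one n -> closure V' `<=` V0 w `&` D m].
    move=> w; have [w1|w1] := eqVneq w (cube_one n).
      by exists setT; split=> //; exact: openT.
    have [||V' [oV' V'c V'D]] := @open_shrink (c' w) (V0 w `&` D m).
    - by apply: openI => //; have [] := V0c w.
    - by split; [exact: Vc'|exact: Dc'].
    by exists V'.
  have q : inv (c', V').
    by split=> //=; [rewrite c'1|move=> w; have [] := V'P w].
  by exists (exist inv _ q) => w w1 /=; have [_ _] := V'P w; apply.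
pose p0 : St := exist inv (c, V) (And3 Cc erefl Vc).
pose p := fix p m := if m is m'.+1 then next (m', p m') else p0.
have pV m w : w != cube_one n ->
    closure ((sval (p m.+1)).2 w) `<=` (sval (p m)).2 w `&` D m.
  by move=> w1; exact: (nextP (m, p m)).
have pin m w : (sval (p m)).2 w ((sval (p m)).1 w).
  by have [_ _ /(_ w)[]] := svalP (p m).
have pmono m j w : w != cube_one n -> (m <= j)%N ->
    (sval (p j)).2 w `<=` (sval (p m)).2 w.
  move=> w1; elim: j => [|j IH]; first by rewrite leqn0 => /eqP ->.
  rewrite leq_eqVlt => /predU1P[->//|/IH]; apply: subset_trans.
  by move=> x /subset_closure/pV[].
(* The neighbourhoods need not shrink to points, so the sequence may diverge; an ultrafilter limit
   is enough, as the closures trap it. *)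
have [U [UU FU]] := ultraFilterLemma eventually_filter.
have /choice[l lP] : forall w : cube n, exists x : X,
    (fun m => (sval (p m)).1 w) @ U --> x.
  by move=> w; exact: compact_ultra_cvg (compact_nilspace_compact hX).
have lcl m w : w != cube_one n -> closure ((sval (p m)).2 w) (l w).
  move=> w1.
  have Uw : \forall j \near U, closure ((sval (p m)).2 w) ((sval (p j)).1 w).
    apply: FU; exists m => // j /= mj; apply: subset_closure.
    exact: pmono mj _ (pin j w).
  exact: (@closed_cvg _ _ U _ _ _ (@closed_closure _ _) Uw _ (lP w)).
exists (upd l (cube_one n) (c (cube_one n))); split.
- apply: (@cube_limit _ _ hX _ U _ (fun m => (sval (p m)).1)).
    by apply: nearW => m; have [] := svalP (p m).
  move=> w; rewrite /upd; have [->|_] := eqVneq w (cube_one n); last exact: lP.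
  have -> : (fun m => (sval (p m)).1 (cube_one n)) = cst (c (cube_one n)).
    by apply/funext => m; have [] := svalP (p m).
  exact: cvg_cst.
- by rewrite /upd eqxx.
- by move=> w w1; rewrite /upd (negPf w1); have [] := pV 0%N w w1 _ (lcl 1%N w w1).
- by move=> w m w1; rewrite /upd (negPf w1); have [] := pV m w w1 _ (lcl m.+1 w w1).
Qed.

End compact_finite_step.

(** * Borel maps *)

(** [A] differs from an open set by a meagre set; the [D m] are dense open sets whose intersection
    avoids the difference. *)
Definition baire_property (X : topologicalType) (A : set X) : Prop :=
  exists V (D : nat -> set X), [/\ open V, forall m, open (D m) /\ dense (D m) &
    forall x, (forall m, D m x) -> (A x <-> V x)].

Lemma baire_property_open (X : topologicalType) (A : set X) :
  open A -> baire_property A.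
Proof.
move=> oA; exists A, (fun=> setT); split=> // m; split; first exact: openT.
by move=> N [x Nx] _; exists x.
Qed.

(** The exterior of [V] differs from its complement by the boundary of [V] only. The extra dense
    open set at index 0 removes this boundary. *)
Lemma baire_property_setC (X : topologicalType) (A : set X) :
  baire_property A -> baire_property (~` A).
Proof.
move=> [V [D [oV DP AV]]].
exists (~` V)°, (fun m => if m is m'.+1 then D m' else V `|` (~` V)°).
split=> [|[|m]|x Dx].
- exact: open_interior.
- split; first by apply: openU => //; exact: open_interior.
  move=> N [x Nx] oN; have [[y [Ny Vy]]|NV] := pselect (N `&` V !=set0).
    by exists y; split=> //; left.
  exists x; split=> //; right; apply: filterS (open_nbhs_nbhs (conj oN Nx)).
  by move=> y Ny Vy; apply: NV; exists y.
- exact: DP.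
have AVx := AV x (fun m => Dx m.+1).
split=> [nAx|/interior_subset nVx /AVx //].
by case: (Dx 0%N) => // /AVx.
Qed.

Lemma baire_property_bigcup (X : topologicalType) (A : nat -> set X) :
  (forall i, baire_property (A i)) -> baire_property (\bigcup_i A i).
Proof.
move=> /choice[V] /choice[D] VD.
(* The doubly indexed dense open sets are listed through codes of pairs; other indices get the whole
   space. *)
exists (\bigcup_i V i), (fun m => if unpickle m is Some p then D p.1 p.2 else setT).
split=> [|m|x Dx].
- by apply: bigcup_open => i _; have [] := VD i.
- case: unpickle => [[i j]|]; first by have [_ /(_ j)] := VD i.
  by split; [exact: openT|move=> N [x Nx] _; exists x].
have Dij i j : D i j x by have := Dx (pickle (i, j)); rewrite pickleK.
have AV i : A i x <-> V i x by have [_ _ /(_ x (Dij i))] := VD i.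
by split=> -[i _ /AV ix]; exists i.
Qed.

Lemma borel_baire_property (X : topologicalType) (A : set X) :
  <<s @open X >> A -> baire_property A.
Proof.
move: A; apply: smallest_sub; last exact: baire_property_open.
split.
- exact/baire_property_open/open0.
- by move=> A BA; rewrite setTD; exact: baire_property_setC.
- exact: baire_property_bigcup.
Qed.

(** The preimages of countably many basic open sets have the Baire property; on the intersection of
    all their dense open sets each of them is relatively open. *)
Lemma borel_continuous_comeager (X Y : topologicalType) (phi : X -> Y) :
  @second_countable Y -> borel_measurable phi ->
  exists D : nat -> set X, (forall m, open (D m) /\ dense (D m)) /\
    forall x W, (forall m, D m x) -> nbhs (phi x) W ->
      exists V, [/\ open V, V x &
        forall y, V y -> (forall m, D m y) -> W (phi y)].
Proof.
move=> [B /countable_injP[f finj] [Bopen Bbasis]] mphi.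
(* An enumeration of the basis by codes; an index that codes no basic set gets the empty set. *)
have /choice[e eP] a : exists G : set Y, open G /\
    forall G', B G' -> f G' = a -> G' = G.
  have [[G [BG fG]]|nB] := pselect (exists G, B G /\ f G = a).
    exists G; split; first exact: Bopen.
    by move=> G' BG' fG'; apply: finj; rewrite ?inE // fG.
  by exists set0; split; [exact: open0|move=> G' BG' fG'; case: nB; exists G'].
have /choice[V /choice[D VD]] a : baire_property (phi @^-1` e a).
  have [oe _] := eP a.
  apply: borel_baire_property; apply: mphi; exact: sub_gen_smallest.
exists (fun m => if unpickle m is Some p then D p.1 p.2 else setT); split.
  move=> m; case: unpickle => [[i j]|]; first by have [_ /(_ j)] := VD i.
  by split; [exact: openT|move=> N [x Nx] _; exists x].
move=> x W Dx Wx.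
have Dij (y : X) : (forall m, (if unpickle m is Some p then D p.1 p.2 else setT) y) ->
    forall i j, D i j y.
  by move=> Dy i j; have := Dy (pickle (i, j)); rewrite pickleK.
have [G [BG Gx] GW] := Bbasis (phi x) W Wx.
have Ge : G = e (f G) by have [_] := eP (f G); apply.
have [oV _ VP] := VD (f G).
exists (V (f G)); split=> //.
  by apply/(VP x (Dij _ Dx _)); rewrite /= -Ge.
by move=> y Vy /Dij Dy; apply: GW; rewrite Ge; exact/(VP y (Dy _)).
Qed.

(** * Passing from continuity on a comeagre set to continuity everywhere *)

Theorem theorem2p4p6 (X Y : topologicalType)
    (CX : cube_family X) (CY : cube_family Y)
    (hX : compact_nilspace CX) (hY : compact_nilspace CY)
    (hXfin : finite_step CX) (hYfin : finite_step CY)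
    (phi : X -> Y)
    (hphi : cubespace_morphism CX CY phi)
    (hborel : borel_measurable phi) :
  continuous phi.
Proof.
have [[kX stepX] [k stepY]] := (hXfin, hYfin).
have [D [DP phiD]] :=
  borel_continuous_comeager (compact_nilspace_countable hY) hborel.
move=> x W Wx; apply: (contrapT (P := nbhs x (phi @^-1` W))) => nWx.
pose one := cube_one k.+1.
(* Starting from the constant cube, this yields a cube with top vertex [x] and all other values in
   every [D m]. *)
have [|w|c [Cc c1 _ Dc]] := @cube_generic _ _ _ hX stepX k.+1 D (fun=> x)
    (fun=> setT) DP.
- exact: cube_const (compact_nilspace_nilspace hX) _ _.
- by split=> //; exact: openT.
(* Cubes near [c] off the top, with generic values there, whose top vertex witnesses discontinuity
   at [x]. *)
pose G (V : cube k.+1 -> set X) := [set c' : cube k.+1 -> X | [/\ CX _ c',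
  forall w, w != one -> V w (c' w), forall w m, w != one -> D m (c' w) &
  ~ W (phi (c' one))]].
pose boxes := [set V : cube k.+1 -> set X | forall w, open (V w) /\ V w (c w)].
(* Every [y] near [x] is the top of a cube near [c], and [cube_generic] makes its other vertices
   generic without changing [y]. So an empty [G V] would make [phi] continuous at [x] with respect
   to [W]. *)
have G0 V : boxes V -> G V !=set0.
  move=> Vc; apply: contrapT => nG; apply: nWx; rewrite -c1.
  have := cube_move_top hX stepX Cc (V := V)
    (fun w => open_nbhs_nbhs (Vc w)).
  apply: filterS => y [c' [Cc' c'y Vc']]; apply: contrapT => nW; apply: nG.
  have [|c2 [Cc2 c21 Vc2 Dc2]] := cube_generic hX stepX (V := V) DP Cc'.
    by move=> w; split=> //; have [] := Vc w.
  by exists c2; split=> //; rewrite -/one c21 c'y.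
have Fproper : ProperFilter (filter_from boxes G).
  apply: filter_from_proper => //; apply: filter_from_filter.
    by exists (fun=> setT) => w; split=> //; exact: openT.
  move=> V V' Vc V'c; exists (fun w => V w `&` V' w).
    move=> w; have [[? ?] [? ?]] := (Vc w, V'c w).
    by split; [exact: openI|split].
  by move=> c' [? VV' ? ?]; split; split=> // w /VV'[].
have [U [UU FU]] := ultraFilterLemma Fproper.
have [y' phiy'] := compact_ultra_cvg (fun c' : cube k.+1 -> X => phi (c' one)) UU
  (compact_nilspace_compact hY).
have boxT : boxes (fun=> setT) by move=> w; split=> //; exact: openT.
have UG : U (G (fun=> setT)) by apply: FU; exists (fun=> setT).
have Cphic : CY _ (phi \o c) by exact: hphi.
have Cd : CY _ (upd (phi \o c) one y').
  apply: (@cube_limit _ _ hY _ U _ (fun c' : cube k.+1 -> X => phi \o c')).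
    by apply: filterS UG => c' [Cc' _ _ _]; exact: hphi.
  move=> w; rewrite /upd; have [->|w1] := eqVneq w one; first exact: phiy'.
  (* Off the top both [c w] and the nearby values are generic, so continuity of [phi] on the
     comeagre set gives the limit. *)
  move=> N Nw; have [V [oV Vcw VN]] := phiD _ _ (fun m => Dc w m w1) Nw.
  apply: FU; exists (fun u => if u == w then V else setT).
    by move=> u; case: eqP => [->//|_]; split=> //; exact: openT.
  move=> c' [_ Vc' Dc' _]; apply: VN; last by move=> m; exact: Dc'.
  by have := Vc' w w1; rewrite eqxx.
(* Both [y'] and [phi x] complete the same (k+1)-corner of [Y]. Hence the images of the top vertices
   converge to [phi x] although they avoid [W]. *)
have y'x : y' = phi x.
  have [|d [_ duniq]] := stepY (phi \o c).
    move=> i; apply: (cubespace_comp (nilspace_cubespace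
      (compact_nilspace_nilspace hY))) => //; exact: cube_face_morphism.
  have <- : upd (phi \o c) one y' one = y' by rewrite /upd eqxx.
  rewrite -c1 -(duniq (upd (phi \o c) one y')).
    by rewrite (duniq (phi \o c)).
  by split=> // w /negPf w1; rewrite /upd -/one w1.
have UW : U [set c' | W (phi (c' one))] by apply: phiy'; rewrite y'x.
by have [c' [[_ _ _ nW] /nW]] := filter_ex (filterI UG UW).
Qed.
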